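(* There is a randomized CONGEST algorithm that, given an undirected unweighted $n$-vertex graph $G$ of diameter $D$ and girth $g$ (length of a shortest cycle), computes with high probability a value $\tilde{g}$ with $g\le \tilde{g}\le \left(2-\frac{1}{g}\right)g$ (the length of a cycle of $G$), in $\tilde{O}(\sqrt{n}+D)$ rounds.
   Context: CONGEST model: the communication network is the undirected graph $G=(V,E)$, $n=|V|$; each node has a unique identifier in $\{0,\dots,n-1\}$, knows its own and its neighbours' identifiers; computation proceeds in synchronous rounds in which each node may send a message of $O(\log n)$ bits to each neighbour; local computation is free. $D$ is the hop diameter of $G$. $\tilde{O}$ hides polylogarithmic factors in $n$. *)

(* Defs.v *)
From HB Require Import structures.
From mathcomp Require Import all_boot all_order all_algebra.

Unset Printing Implicit Defensive.

Definition simple_graph {n : nat} (G : rel 'I_n) : Prop :=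
  (forall u v, G u v = G v u) /\ (forall v, ~~ G v v).

Fixpoint within {n : nat} (G : rel 'I_n) (d : nat) (u v : 'I_n) : bool :=
  match d with
  | 0 => u == v
  | d'.+1 => within G d' u v || [exists w, within G d' u w && G w v]
  end.

Definition is_diameter {n : nat} (G : rel 'I_n) (D : nat) : Prop :=
  (forall u v, within G D u v) /\
  (forall d, (forall u v, within G d u v) -> D <= d).

Definition has_cycle_of_length {n : nat} (G : rel 'I_n) (L : nat) : bool :=
  (3 <= L) && [exists s : L.-tuple 'I_n, uniq s && cycle G s].

Definition is_girth {n : nat} (G : rel 'I_n) (g : nat) : Prop :=
  has_cycle_of_length G g /\ forall L, has_cycle_of_length G L -> g <= L.

(* Messages are natural numbers (bit strings); [None] = no message.
   A node's local knowledge: n (through the type), its own identifier,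
   the set of identifiers of its neighbours, its private random tape, and the
   full history of messages received (round by round, indexed by sender).
   Since local computation is free, the state is w.l.o.g. this full history. *)
Definition history (n : nat) := seq ('I_n -> option nat).

Record congest_alg := CongestAlg {
  rbits : nat -> nat;
  send : forall n : nat, 'I_n -> {set 'I_n} -> (rbits n).-tuple bool ->
           history n -> 'I_n -> option nat;
  output : forall n : nat, 'I_n -> {set 'I_n} -> (rbits n).-tuple bool ->
           history n -> option nat            (* Some x = halt with output x *)
}.

Definition nbrs {n : nat} (G : rel 'I_n) (v : 'I_n) : {set 'I_n} :=
  [set w | G v w].

Definition msg_bounded (A : congest_alg) (cB : nat) : Prop :=
  forall n v N tape h u m, @send A n v N tape h u = Some m ->
    m < 2 ^ (cB * (trunc_log 2 n).+1).

Fixpoint hist (A : congest_alg) {n : nat} (G : rel 'I_n)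
  (tapes : {ffun 'I_n -> (rbits A n).-tuple bool}) (r : nat) : 'I_n -> history n :=
  match r with
  | 0 => fun _ => [::]
  | r'.+1 => fun v =>
      rcons (hist A G tapes r' v)
        (fun u => if G u v then @send A n u (nbrs G u) (tapes u) (hist A G tapes r' u) v
                  else None)
  end.

Definition out_at (A : congest_alg) {n : nat} (G : rel 'I_n)
  (tapes : {ffun 'I_n -> (rbits A n).-tuple bool}) (r : nat) (v : 'I_n) : option nat :=
  @output A n v (nbrs G v) (tapes v) (hist A G tapes r v).

Definition first_output (A : congest_alg) {n : nat} (G : rel 'I_n)
  (tapes : {ffun 'I_n -> (rbits A n).-tuple bool}) (T : nat) (v : 'I_n) : option nat :=
  foldr (fun r acc => if out_at A G tapes r v is Some x then Some x else acc)
        None (iota 0 T.+1).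

Definition round_bound (c k n D : nat) : nat :=
  c * ((Nat.sqrt n).+1 + D) * ((trunc_log 2 n).+1) ^ k.

(* Main.v *)
(** Take a shortest cycle C, of length g, and let r be the integer part of (g - 1) / 2.
    If some sampled vertex s lies within r of C, then among the edges of C at a
    vertex of C farthest from s there is a non-tree edge xy of the BFS tree of s, and
    d(s,x) + d(s,y) + 1 <= 2 d(s,C) + g <= 2g - 1.  Otherwise, with high probability
    (each vertex being sampled with probability about 1 / sqrt n) all balls of radius
    r around C are small; then a pipelined BFS from all vertices, in which every
    node announces its nearest pending source first, reaches across these balls in
    O~(sqrt n + D) rounds, and the same argument with s on C gives a value at most g.
    The best triple (s, xy) is elected by flooding.  A length must be that of an
    actual cycle, so two tokens then climb from x and y towards s; the minimum, over
    the vertices visited by both, of the two hop counts plus one is the length of the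
    cycle closed by xy at the meeting point, and this minimum is flooded as the output.

    The diameter is unknown to the nodes.  Each node maintains the last round in which it
    knows that some node had not yet been reached by a BFS from node 0; once
    the clock exceeds about three times this value, the value is final, equal to the
    eccentricity of node 0 minus one at every node, so that all nodes change phase
    simultaneously. *)

Require Import Defs.
From mathcomp Require Import all_boot all_order all_algebra.
From Stdlib Require PeanoNat.
From mathcomp Require Import zify.
Import GRing.Theory Num.Theory.

Set Implicit Arguments.
Unset Strict Implicit.

(** * The algorithm *)

Section Node.
Variable n : nat.

(* A distance and a source. *)
Notation entry := ('I_n * 'I_n)%type.
Notation label := (bool * 'I_n * 'I_n * 'I_n)%type.
(* [Some (w, (b, s, x, y))]: in instance [b] of the source detection, the walk from
   [s] to [x], the edge [xy] and the walk from [y] back to [s] have total length [w]. *)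
Notation witness := (option ('I_(2 * n).+1 * label)).
Definition message : finType :=
  (bool * 'I_n.+1 * {ffun bool -> option entry} * witness *
   {ffun bool -> option 'I_(2 * n).+1} * option 'I_n * 'I_(4 * n).+3)%type.

(** Lexicographic order: nearer sources are announced first, and ties are broken by the identifier
    of the source. *)
Definition entry_key (p : entry) : nat := p.1 * n + p.2.

(** Lexicographic in length and label, so that the minimum is unique and all nodes elect the same
    edge; [None] is the largest. *)
Definition witness_key (z : witness) : nat :=
  if z is Some (w, l) then w * #|{: label}| + enum_rank l
  else (2 * n).+1 * #|{: label}|.

(* [late] is the last time at which some node is known to have been unreached by the
   BFS from node 0.  The boolean argument of [heard] and [told] selects the instance
   of source detection ([true]: all vertices are sources, [false]: the sampled ones),
   that of [mark] the end of the elected edge whose token has visited the node. *)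
Record node := Node {
  clock : nat;
  reached : bool;
  late : nat;
  heard : bool -> {set 'I_n * entry};
  told : bool -> {set entry};
  best : witness;
  mark : bool -> option 'I_(2 * n).+1;
  res : 'I_(4 * n).+3 }.

Definition knows (v : 'I_n) (own : bool) (H : {set 'I_n * entry})
    (d : nat) (s : 'I_n) : bool :=
  [&& own, d == 0 & s == v] ||
  [exists q : 'I_n * entry, [&& q \in H, q.2.2 == s & q.2.1.+1 == d]].

(** The value is [n.+1] when no distance from [s] is known. *)
Definition est v own (H : {set 'I_n * entry}) (s : 'I_n) : nat :=
  find (fun d => knows v own H d s) (iota 0 n.+1).

Definition par v own (H : {set 'I_n * entry}) (s : 'I_n) : option 'I_n :=
  [pick u : 'I_n | [exists q : 'I_n * entry, [&& q \in H, q.1 == u, q.2.2 == s &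
                           q.2.1.+1 == est v own H s]]].

(** The default [z0] competes too, so a node that passes its current value never gets worse. *)
Definition minimizer (T : finType) (key : T -> nat) (z0 : T) (P : pred T) : T :=
  [arg min_(z < z0 | (z == z0) || P z) key z].

Variables (B : nat) (v : 'I_n) (smp : bool).

(* Ends of the phases (detection, election, token climbing, final flooding) when the
   final value of [late] is [a], so that the diameter is at most [2 * a + 2]. *)
Definition R1 a := 5 * a + 10 + B.
Definition R2 a := R1 a + (2 * a + 4).
Definition R3 a := R2 a + (4 * a + 8).
Definition R4 a := R3 a + (2 * a + 4).

(** The initial result [ord_max], that is [4 * n + 2], stands for no proposal: two hop counts plus
    one make at most [4 * n + 1]. *)
Definition start : node :=
  Node 0 (v == 0 :> nat) 0 (fun=> set0) (fun=> set0) None (fun=> None) ord_max.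

(** An announced estimate that was too large can still be corrected later, by a strictly smaller
    one. *)
Definition eligible (x : node) (b : bool) (p : entry) : bool :=
  knows v (b || smp) (heard x b) p.1 p.2 &&
  ~~ [exists d : 'I_n, (d <= p.1) && ((d, p.2) \in told x b)].

Definition announce (x : node) (b : bool) : option entry :=
  if R1 (late x) <= clock x then None else
  [pick p | eligible x b p &&
     [forall q, eligible x b q ==> (entry_key p <= entry_key q)]].

Definition best_par (x : node) : option 'I_n :=
  if best x is Some (_, (b, s, _, _))
  then par v (b || smp) (heard x b) s else None.

Definition speak (x : node) : message :=
  (reached x, inord (late x), [ffun b => announce x b], best x,
   [ffun sd => mark x sd], best_par x, res x).

(** The edge must lie outside the tree: [y] is not the parent of [x'], and [d <= e] prevents [x']
    from being the parent of [y]. *)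
Definition is_candidate (x : node) (z : witness) : bool :=
  if z is Some (w, (b, s, x', y)) then
    let e := est v (b || smp) (heard x b) s in
    [&& x' == v, par v (b || smp) (heard x b) s != Some y &
      [exists d : 'I_n, [&& (y, (d, s)) \in heard x b, d <= e &
                            w == (e + d).+1 :> nat]]]
  else false.

Section Step.
Variables (x : node) (inbox : {ffun 'I_n -> option message}).

Definition hears (P : 'I_n -> message -> bool) : bool :=
  [exists u, if inbox u is Some m then P u m else false].

Definition m_reached (m : message) := m.1.1.1.1.1.1.
Definition m_late (m : message) := m.1.1.1.1.1.2.
Definition m_entry (m : message) := m.1.1.1.1.2.
Definition m_best (m : message) := m.1.1.1.2.
Definition m_mark (m : message) := m.1.1.2.
Definition m_par (m : message) := m.1.2.
Definition m_res (m : message) := m.2.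

Definition step : node :=
  let r := reached x || hears (fun _ m => m_reached m) in
  Node (clock x).+1 r
    (if r then maxn (late x)
       (\max_u (if inbox u is Some m then m_late m : nat else 0))
     else (clock x).+1)
    (fun b => heard x b :|: [set q | if inbox q.1 is Some m
                                     then m_entry m b == Some q.2 else false])
    (fun b => told x b :|: [set p | announce x b == Some p])
    (if clock x == R1 (late x)
     then minimizer witness_key None (is_candidate x)
     else minimizer witness_key (best x) (fun z => hears (fun _ m => m_best m == z)))
    (fun sd =>
       if clock x == R2 (late x) then
         if best x is Some (_, (_, _, y0, y1)) then
           if v == (if sd then y1 else y0) then Some ord0 else None
         else None
       else if mark x sd is Some c then Some c
       else [pick c : 'I_(2 * n).+1 | hears (fun _ m =>
              (m_par m == Some v) &&
              (if m_mark m sd is Some c0 then c0.+1 == c else false))])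
    (if clock x == R3 (late x) then
       if (mark x false, mark x true) is (Some c0, Some c1)
       then inord (c0 + c1).+1 else ord_max
     else minimizer (@nat_of_ord _) (res x) (fun z => hears (fun _ m => m_res m == z))).

End Step.

Definition decode (k : nat) : option message :=
  omap (fun i : 'I_#|message| => enum_val i) (insub k).

Definition encode (m : message) : nat := enum_rank m.

Lemma encodeK m : decode (encode m) = Some m.
Proof. by rewrite /decode /encode valK /= enum_rankK. Qed.

Definition replay (h : history n) : node :=
  foldl (fun x row => step x [ffun u => obind decode (row u)]) start h.

End Node.

Definition girth_alg (bits budget : nat -> nat) : congest_alg :=
  @CongestAlg bits
    (fun n v _ tape h _ => Some (encode (speak (budget n) v (all id tape)
                               (replay (budget n) v (all id tape) h))))
    (fun n v _ tape h =>
       let x := replay (budget n) v (all id tape) h in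
       if clock x == R4 (budget n) (late x) then Some (res x : nat) else None).

(** Every field of a message takes at most a fixed power of [P] values, where [n < P]; the exponents
    add up to 21. *)
Lemma girth_alg_msg_bounded bits budget : msg_bounded (girth_alg bits budget) 24.
Proof.
move=> n v N tape h u m [<-]; apply: leq_trans (ltn_ord _) _.
set P := 2 ^ (trunc_log 2 n).+1.
have nP : n.+1 <= P by apply: trunc_log_ltn.
have P2 : 2 <= P by rewrite /P expnS leq_pmulr // expn_gt0.
rewrite mulnC expnM -/P.
have cardE : #|message n| = 2 * n.+1 * (n * n).+1 ^ 2 *
    ((2 * n).+1 * (2 * n * n * n)).+1 * (2 * n).+2 ^ 2 * n.+1 * (4 * n).+3.
  rewrite !card_prod !card_ffun card_bool !card_option !card_ord.
  by rewrite !card_prod card_bool !card_ord.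
rewrite cardE.
have le2 a b i j : a <= P ^ i -> b <= P ^ j -> a * b <= P ^ (i + j).
  by rewrite expnD; apply: leq_mul.
have nP1 : n <= P ^ 1 by rewrite expn1 ltnW.
have nP1' : n.+1 <= P ^ 1 by rewrite expn1.
have P2' : 2 <= P ^ 1 by rewrite expn1.
have E0 : (n * n).+1 <= P ^ 2 by rewrite expnS expn1; nia.
have E1 : (2 * n).+1 <= P ^ 2 by rewrite expnS expn1; nia.
have E1' : (2 * n).+2 <= P ^ 2 by rewrite expnS expn1; nia.
have E2 : (4 * n).+3 <= P ^ 3 by rewrite !expnS expn0; nia.
have E3 : ((2 * n).+1 * (2 * n * n * n)).+1 <= P ^ 7.
  have F : (2 * n).+1 * (2 * n * n * n) <= P ^ (2 + (1 + 1 + 1 + 1)).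
    by apply: (le2 _ _ _ _) => //; do 3!apply: (le2 _ _ _ _) => //.
  have F0 : 0 < P ^ 6 by rewrite expn_gt0 (ltnW P2).
  rewrite (expnS P 6); apply: (@leq_trans (2 * P ^ 6)); last by rewrite leq_mul2r P2 orbT.
  by move: F F0; rewrite (_ : 2 + _ = 6) //; lia.
have E4 : (n * n).+1 ^ 2 <= P ^ 4 by rewrite (expnM P 2 2) leq_exp2r.
have E5 : (2 * n).+2 ^ 2 <= P ^ 4 by rewrite (expnM P 2 2) leq_exp2r.
apply: (@leq_trans (P ^ (1 + 1 + 4 + 7 + 4 + 1 + 3))).
  apply: (le2 _ _ _ _) => //; apply: (le2 _ _ _ _) => //; apply: (le2 _ _ _ _) => //.
  by apply: (le2 _ _ _ _) => //; apply: (le2 _ _ _ _) => //; apply: (le2 _ _ _ _).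
by rewrite leq_exp2l.
Qed.

(** * Distances *)

Section Distance.
Variables (n : nat) (G : rel 'I_n).
Implicit Types u v w s : 'I_n.

Lemma within_refl d u : within G d u u.
Proof. by elim: d => [|d IH] /=; rewrite ?eqxx // IH. Qed.

Lemma within_mono d d' u v : d <= d' -> within G d u v -> within G d' u v.
Proof.
move=> /subnKC <-; elim: (d' - d) => [|k IH]; first by rewrite addn0.
by move=> /IH H; rewrite addnS /= H.
Qed.

Lemma within_step d u v w : within G d u w -> G w v -> within G d.+1 u v.
Proof. by move=> H1 H2 /=; apply/orP; right; apply/existsP; exists w; rewrite H1. Qed.

Lemma within_trans d1 d2 u v w :
  within G d1 u v -> within G d2 v w -> within G (d1 + d2) u w.
Proof.
move=> H1; elim: d2 w => [|d IH] w /=; first by rewrite addn0 => /eqP <-.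
rewrite addnS => /orP[/IH/within_mono-> //|/existsP[x /andP[/IH Hx Gx]]].
exact: within_step Hx Gx.
Qed.

Lemma within_path d u v : within G d u v ->
  exists p, [/\ path G u p, last u p = v & size p <= d].
Proof.
elim: d v => [|d IH] v /=; first by move=> /eqP <-; exists [::].
move=> /orP[/IH[p [p1 p2 p3]]|/existsP[w /andP[/IH[p [p1 p2 p3]] Gwv]]].
  by exists p; split=> //; apply: leqW.
exists (rcons p v); split; last by rewrite size_rcons.
  by rewrite rcons_path p1 p2.
by rewrite last_rcons.
Qed.

Lemma path_within u p : path G u p -> within G (size p) u (last u p).
Proof.
elim/last_ind: p => [|p x IH]; first by rewrite /= eqxx.
rewrite rcons_path size_rcons last_rcons => /andP[/IH H1 H2].
exact: within_step H1 H2.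
Qed.

(** A path shortens to a simple one, which has fewer than [n] edges. Connectivity can thus be stated
    without the diameter. *)
Lemma within_pred_card d u v : within G d u v -> within G n.-1 u v.
Proof.
move=> /within_path[p [Gp <- _]]; case/shortenP: Gp => p' Gp' Up' _.
apply: within_mono (path_within Gp'); have := max_card (mem (u :: p')).
by move/card_uniqP: Up' => ->; rewrite card_ord /=; lia.
Qed.

Hypothesis Gsym : forall u v, G u v = G v u.

Lemma within_sym d u v : within G d u v -> within G d v u.
Proof.
elim: d v => [|d IH] v /=; first by rewrite eq_sym.
move=> /orP[/IH -> //|/existsP[w /andP[/IH H1 H2]]].
apply: (@within_trans 1 d v w u) => //.
by apply: (@within_step 0 v w v); rewrite /= ?eqxx // Gsym.
Qed.

Hypothesis connected : forall u v, within G n.-1 u v.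

Definition dst u v : nat := find (fun d => within G d u v) (iota 0 n).

Lemma has_dst u v : has (fun d => within G d u v) (iota 0 n).
Proof.
apply/hasP; exists n.-1 => //; rewrite mem_iota add0n.
by have := ltn_ord u; lia.
Qed.

Lemma ltn_dst u v : dst u v < n.
Proof. by have := has_dst u v; rewrite has_find size_iota. Qed.

Lemma withinE d u v : within G d u v = (dst u v <= d).
Proof.
have H : within G (dst u v) u v.
  by have := nth_find 0 (has_dst u v); rewrite nth_iota ?ltn_dst.
apply/idP/idP => [Hd|Hd]; last exact: within_mono Hd H.
rewrite leqNgt; apply/negP => Hlt; have := before_find 0 Hlt.
by rewrite nth_iota ?Hd // (ltn_trans Hlt (ltn_dst u v)).
Qed.

Lemma dst_refl u : dst u u = 0.
Proof. by apply/eqP; rewrite -leqn0 -withinE within_refl. Qed.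

Lemma dst_eq0 u v : (dst u v == 0) = (u == v).
Proof. by rewrite -leqn0 -withinE. Qed.

Lemma dst_sym u v : dst u v = dst v u.
Proof.
by apply/eqP; rewrite eqn_leq -!withinE; apply/andP; split; apply: within_sym;
  rewrite withinE.
Qed.

Lemma dst_triangle u v w : dst u w <= dst u v + dst v w.
Proof. by rewrite -withinE; apply: (@within_trans _ _ _ v); rewrite withinE. Qed.

Lemma dst_edge s u v : G u v -> dst s v <= (dst s u).+1.
Proof. by move=> H; rewrite -withinE; apply: within_step H; rewrite withinE. Qed.

Lemma dst_pred s v d : dst s v = d.+1 -> exists2 u, G u v & dst s u = d.
Proof.
move=> E; have : within G d.+1 s v by rewrite withinE E.
rewrite /= withinE E ltnn /= => /existsP[u /andP[]]; rewrite withinE => H1 H2.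
by exists u => //; apply/eqP; rewrite eqn_leq H1 -ltnS -E dst_edge.
Qed.

Lemma dst_level s v d : d <= dst s v -> exists u, dst s u = d.
Proof.
move: {2}(dst s v) (erefl (dst s v)) => m; elim: m v => [|m IH] v E.
  by rewrite E leqn0 => /eqP ->; exists v.
rewrite E leq_eqVlt => /orP[/eqP->|]; first by exists v.
by have [w _ Ew] := dst_pred E; rewrite ltnS -Ew => /(IH _ Ew).
Qed.

End Distance.

(** * Synchronous execution *)

Section Run.
Variables (n B : nat) (G : rel 'I_n) (smp : 'I_n -> bool).

Fixpoint run (t : nat) (v : 'I_n) : node n :=
  if t is t'.+1 then
    step B v (smp v) (run t' v)
      [ffun u => if G u v then Some (speak B u (smp u) (run t' u)) else None]
  else start v.

Notation said t u := (speak B u (smp u) (run t u)).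

Lemma hearsE t v P :
  hears [ffun u => if G u v then Some (said t u) else None] P =
  [exists u, G u v && P u (said t u)].
Proof. by apply: eq_existsb => u; rewrite ffunE; case: (G u v). Qed.

Lemma run_clock t v : clock (run t v) = t.
Proof. by elim: t v => //= t IH v; rewrite IH. Qed.

Lemma run_reached t v : reached (run t v) = [exists u : 'I_n, (u == 0 :> nat) && within G t u v].
Proof.
elim: t v => [|t IH] v /=.
  apply/idP/existsP => [v0|[u /andP[u0 /eqP <-]]] //.
  by exists v; rewrite v0 eqxx.
rewrite hearsE IH; apply/orP/existsP => [[/existsP[u]|/existsP[u /andP[Gu]]]|].
- by move=> /andP[u0 H]; exists u; rewrite u0 H.
- rewrite /m_reached /= IH => /existsP[w /andP[w0 H]]; exists w.
  by rewrite w0 /=; apply/orP; right; apply/existsP; exists u; rewrite H.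
move=> [u /andP[u0 /orP[H|/existsP[w /andP[H Gw]]]]].
  by left; apply/existsP; exists u; rewrite u0.
right; apply/existsP; exists w; rewrite Gw /m_reached /= IH.
by apply/existsP; exists u; rewrite u0.
Qed.

Lemma run_heard t v b : heard (run t v) b =
  [set q : 'I_n * ('I_n * 'I_n) | G q.1 v && (q.2 \in told (run t q.1) b)].
Proof.
elim: t v => [|t IH] v; first by apply/setP=> q; rewrite /= !inE andbF.
apply/setP=> q; rewrite [LHS]/= [RHS]/= IH in_setU 3!in_set ffunE.
by case: (G q.1 v); rewrite //= /m_entry /= ffunE in_setU in_set.
Qed.

Lemma told_runS t v b :
  told (run t.+1 v) b = told (run t v) b :|: [set p | announce B v (smp v) (run t v) b == Some p].
Proof. by []. Qed.

Lemma told_mono t t' v b : t <= t' -> told (run t v) b \subset told (run t' v) b.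
Proof.
move=> /subnKC <-; elim: (t' - t) => [|k IH]; first by rewrite addn0.
by rewrite addnS told_runS (subset_trans IH) // subsetUl.
Qed.

Definition run_knows t b v d s := knows v (b || smp v) (heard (run t v) b) d s.

Lemma run_knowsP t b v d s : reflect
  (((b || smp v) /\ d = 0 /\ s = v) \/
   exists u (d' : 'I_n), [/\ G u v, (d', s) \in told (run t u) b & d = d'.+1])
  (run_knows t b v d s).
Proof.
apply: (iffP orP) => [[/and3P[H1 /eqP-> /eqP->]|/existsP[[u [d' s']]]]|].
- by left.
- rewrite run_heard inE /= => /and3P[/andP[H1 H2] /eqP <- /eqP <-].
  by right; exists u, d'.
move=> [[H1 [-> ->]]|[u [d' [H1 H2 ->]]]]; first by left; rewrite H1 !eqxx.
by right; apply/existsP; exists (u, (d', s)); rewrite run_heard inE /= H1 H2 !eqxx.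
Qed.

Lemma run_knows_mono t t' b v d s : t <= t' -> run_knows t b v d s -> run_knows t' b v d s.
Proof.
move=> tt' /run_knowsP[H|[u [d' [H1 H2 H3]]]]; apply/run_knowsP; first by left.
by right; exists u, d'; rewrite (subsetP (told_mono _ _ tt')).
Qed.

Lemma told_knows t b v p :
  p \in told (run t v) b -> run_knows t b v p.1 p.2.
Proof.
elim: t => [|t IH]; first by rewrite /= inE.
rewrite told_runS !inE => /orP[/IH|]; first exact: run_knows_mono.
rewrite /announce; case: ifP => // _; case: pickP => // p' /andP[/andP[H _] _] /eqP[<-].
exact: run_knows_mono H.
Qed.

Lemma run_est t b v s d : d <= n -> run_knows t b v d s ->
  est v (b || smp v) (heard (run t v) b) s <= d.
Proof.
move=> dn H; rewrite leqNgt; apply/negP => /(before_find 0).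
by rewrite nth_iota //= add0n -/(run_knows t b v d s) H.
Qed.

Lemma knows_est t b v s : 
  est v (b || smp v) (heard (run t v) b) s <= n ->
  run_knows t b v (est v (b || smp v) (heard (run t v) b) s) s.
Proof.
rewrite -ltnS => H.
have Hh : has (fun d => knows v (b || smp v) (heard (run t v) b) d s) (iota 0 n.+1).
  by rewrite has_find size_iota.
by have := nth_find 0 Hh; rewrite nth_iota.
Qed.

End Run.

(** Decoding inverts encoding, so replaying a history recomputes the state of the node; the analysis
    can work with [run] alone. *)
Lemma hist_run bits budget n (G : rel 'I_n)
    (tapes : {ffun 'I_n -> (rbits (girth_alg bits budget) n).-tuple bool}) t v :
  replay (budget n) v (all id (tapes v)) (hist (girth_alg bits budget) G tapes t v) =
  run (budget n) G (fun u => all id (tapes u)) t v.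
Proof.
elim: t v => [|t IH] v //.
rewrite [in LHS]/replay [hist _ _ _ _]/= foldl_rcons -[foldl _ _ _]/(replay _ _ _ _) IH.
congr step; apply/ffunP => u; rewrite !ffunE; case: (G u v) => //=.
by rewrite encodeK IH.
Qed.

(** * Agreement on the phases *)

Lemma R1_ge B a : 3 * a + 4 <= R1 B a.
Proof. rewrite /R1; lia. Qed.

Lemma R2_ge B a : 3 * a + 4 <= R2 B a.
Proof. rewrite /R2 /R1; lia. Qed.

Lemma R3_ge B a : 3 * a + 4 <= R3 B a.
Proof. rewrite /R3 /R2 /R1; lia. Qed.

Lemma R4_ge B a : 3 * a + 4 <= R4 B a.
Proof. rewrite /R4 /R3 /R2 /R1; lia. Qed.

Section Sync.
Variables (n B : nat) (G : rel 'I_n) (smp : 'I_n -> bool).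
Hypothesis Gsym : forall u v, G u v = G v u.
Hypothesis connected : forall u v, within G n.-1 u v.
Variable root : 'I_n.
Hypothesis root0 : root = 0 :> nat.

Notation dst := (dst G).
Notation run := (run B G smp).

Definition ecc : nat := \max_v dst root v.
Definition last_late : nat := ecc.-1.

Lemma dst_ecc v : dst root v <= ecc.
Proof. exact: leq_bigmax. Qed.

Lemma dst_last_late u v : dst u v <= 2 * last_late + 2.
Proof.
have := dst_triangle connected u root v; rewrite (dst_sym Gsym connected u root).
have := dst_ecc u; have := dst_ecc v; rewrite /last_late; lia.
Qed.

Lemma last_late_le D : (forall u v, within G D u v) -> last_late <= D.
Proof.
move=> H; apply: leq_trans (leq_pred _) _; apply/bigmax_leqP => v _.
by rewrite -(withinE connected).
Qed.

Lemma ltn_last_late : last_late <= n.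
Proof.
apply: leq_trans (leq_pred _) _; apply/bigmax_leqP => v _.
by rewrite ltnW // (ltn_dst connected).
Qed.

Lemma reachedE t v : reached (run t v) = (dst root v <= t).
Proof.
rewrite run_reached -(withinE connected); apply/existsP/idP => [[u /andP[/eqP u0]]|H].
  by rewrite (_ : u = root) //; apply: val_inj; rewrite /= u0 root0.
by exists root; rewrite root0.
Qed.

Lemma late_runS t v : late (run t.+1 v) =
  if dst root v <= t.+1 then
    maxn (late (run t v))
      (\max_(u | G u v) (inord (late (run t u)) : 'I_n.+1))
  else t.+1.
Proof.
rewrite -reachedE -[RHS]/(if reached (run t.+1 v) then _ else _).
rewrite [in RHS]big_mkcond [LHS]/= run_clock.
congr (if _ then maxn _ _ else _); apply: eq_bigr => u _.
by rewrite ffunE; case: (G u v).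
Qed.

Lemma late_le t v : late (run t v) <= last_late.
Proof.
elim: t v => [|t IH] v //; rewrite late_runS; case: (leqP (dst root v)) => [_|H].
  rewrite geq_max IH; apply/bigmax_leqP => u _.
  (* The value is at most [n], so its message field holds it and [inord] loses nothing. *)
  by rewrite inordK ?IH // ltnS (leq_trans (IH u)) // ltn_last_late.
by have := leq_trans H (dst_ecc v); rewrite /last_late; lia.
Qed.

(** The node [u], unreached at time [tau], records [tau], and the record spreads by one hop per
    round; a node still unreached holds an even later time. *)
Lemma late_ge tau k u v :
  tau < dst root u -> dst u v <= k -> tau <= late (run (tau + k) v).
Proof.
move=> Hu; elim: k v => [|k IH] v.
  rewrite leqn0 (dst_eq0 connected) => /eqP <-; rewrite addn0.
  by case: tau Hu => // tau Hu; rewrite late_runS ifN // -ltnNge.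
move=> Hv; rewrite addnS late_runS; case: (leqP (dst root v)) => _; last by lia.
rewrite leq_max; case: (leqP (dst u v) k) => [/IH -> //|Hk].
have E : dst u v = k.+1 by apply/eqP; rewrite eqn_leq Hv.
have [w Gwv Ew] := dst_pred connected E.
apply/orP; right; apply: (bigmax_sup w) => //.
rewrite inordK ?IH ?Ew // ltnS.
exact: leq_trans (late_le _ _) ltn_last_late.
Qed.

(* If [late] were below its final value, some node at distance [late + 2] from
   the root would be within [2 * late + 3] of [v], and its lateness would have
   arrived by now. *)
Lemma late_final t v : 3 * late (run t v) + 4 <= t -> late (run t v) = last_late.
Proof.
set a := late _ => Ht; apply/eqP; rewrite eqn_leq late_le /= leqNgt.
apply/negP => Ha.
have Hge u : a.+1 < dst root u -> dst u v <= t - a.+1 -> False.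
  by move=> H1 H2; have := late_ge H1 H2; rewrite subnKC -/a; lia.
have [u0 Eu0] : {u0 | ecc = dst root u0}.
  by apply: eq_bigmax; apply/card_gt0P; exists root.
have [u Eu] : exists u, dst root u = a.+2.
  by apply: (@dst_level _ _ connected root u0); rewrite -Eu0 /last_late in Ha *; lia.
have Hv : dst root v <= a.+1.
  by rewrite leqNgt; apply/negP => /Hge; apply; rewrite (dst_refl connected).
apply: (Hge u); first by rewrite Eu.
have := dst_triangle connected u root v; rewrite (dst_sym Gsym connected u root) Eu.
lia.
Qed.

(** Either inequality puts [t] past the time from which the local value is final. Hence all nodes
    take the same decision without knowing whether their value is final. *)
Lemma late_before f t v : (forall a, 3 * a + 4 <= f a) ->
  (f (late (run t v)) <= t) = (f last_late <= t).
Proof.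
move=> Hf; apply/idP/idP => H.
  by rewrite -(late_final (leq_trans (Hf _) H)).
rewrite late_final //; apply: leq_trans H; apply: leq_trans (Hf _).
by rewrite leq_add2r leq_mul2l late_le orbT.
Qed.

Lemma late_at f t v : (forall a, 3 * a + 4 <= f a) ->
  (t == f (late (run t v))) = (t == f last_late).
Proof.
move=> Hf; have H := late_before t v Hf; apply/eqP/eqP => E.
  by rewrite -(@late_final t v) // (leq_trans (Hf _)) // -E.
by rewrite (@late_final t v) // (leq_trans (Hf _)) // H E.
Qed.

End Sync.

(** * Source detection *)

Section Detection.
Variables (n B : nat) (G : rel 'I_n) (smp : 'I_n -> bool).
Hypothesis Gsym : forall u v, G u v = G v u.
Hypothesis connected : forall u v, within G n.-1 u v.
Notation dst := (dst G).
Notation run := (run B G smp).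

Definition dst_key s v := dst s v * n + s.
Definition dst_ord s v : 'I_n := Ordinal (ltn_dst connected s v).
Definition rank (b : bool) s v :=
  #|[set s' | (b || smp s') && (dst_key s' v < dst_key s v)]|.

Lemma entry_key_inj : injective (@entry_key n).
Proof.
move=> [d s] [d' s']; rewrite /entry_key /= => E.
have n0 : 0 < n by apply: leq_ltn_trans (ltn_ord s).
have Ed : d = d'.
  apply: val_inj; have := congr1 (divn^~ n) E.
  by rewrite /= !divnMDl // !divn_small // !addn0.
by congr pair => //; apply: val_inj; move: E; rewrite Ed => /addnI.
Qed.

(** Every known entry is the length of an actual walk from a source, so estimates never
    undershoot. *)
Lemma knows_dst t b v d s : run_knows B G smp t b v d s -> (b || smp s) /\ dst s v <= d.
Proof.
elim: t v d => [|t IH] v d /run_knowsP[[H [-> ->]]|[u [d' [Gu Hd ->]]]];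
  rewrite ?(dst_refl connected) //; first by move: Hd; rewrite /= inE.
have [H1 H2] : (b || smp s) /\ dst s u <= d'.
  move: Hd; rewrite told_runS in_setU => /orP[/told_knows/IH //|].
  rewrite inE /announce; case: ifP => // _; case: pickP => // p /andP[/andP[H _] _].
  by move=> /eqP[E]; apply: IH; rewrite E in H.
by split=> //; apply: leq_trans (dst_edge connected s Gu) _.
Qed.

Lemma told_dst t b v (d s : 'I_n) :
  (d, s) \in told (run t v) b -> (b || smp s) /\ dst s v <= d.
Proof. by move/told_knows/knows_dst. Qed.

(** Sources ahead of [s] at [v] are no farther than [s], hence lie in the ball, as does [s], which
    is not counted. *)
Lemma rank_all b s v r : dst s v <= r -> rank b s v < #|[set u | within G r v u]|.
Proof.
move=> Hr; apply: proper_card; apply/properP; split.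
  apply/subsetP => x; rewrite !inE => /andP[_].
  rewrite (withinE connected) (dst_sym Gsym connected) /dst_key.
  by have := ltn_ord s; nia.
exists s; rewrite !inE ?ltnn ?andbF //.
by rewrite (withinE connected) (dst_sym Gsym connected).
Qed.

Lemma rank_sample s v : rank false s v <= #|[set u | smp u]|.
Proof.
by apply: subset_leq_card; apply/subsetP => x; rewrite !inE /= => /andP[].
Qed.

Variable root : 'I_n.
Hypothesis root0 : root = 0 :> nat.

Notation deadline := (R1 B (last_late G root)).

(* A true entry [(dst s v, s)] is announced once the smaller true entries are out
   of the way; stale entries never overtake it, because a known pair [(d', s')]
   is superseded as soon as [(dst s' v, s')] has been announced. *)
Lemma detection t b s v : b || smp s -> dst s v + rank b s v < t -> t <= deadline ->
  (dst_ord s v, s) \in told (run t v) b.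
Proof.
elim: t s v => [|t IH] s v // Hs; rewrite ltnS leq_eqVlt => Hr Ht.
have [Hr'|E] : dst s v + rank b s v < t \/ dst s v + rank b s v = t.
  by move: Hr => /orP[/eqP|]; auto.
  by apply: (subsetP (told_mono B G smp v b (leqnSn t))); apply: IH; rewrite // ltnW.
have rank_lt s' w : dst_key s' w < dst_key s w -> b || smp s' -> rank b s' w < rank b s w.
  move=> Hk Hs'; apply: proper_card; apply/properP; split.
    apply/subsetP => x; rewrite !inE => /andP[-> /ltn_trans]; exact.
  by exists s'; rewrite !inE ?ltnn ?andbF // Hs'.
have Hknow : run_knows B G smp t b v (dst s v) s.
  apply/run_knowsP; case Ed: (dst s v) => [|d].
    by left; move/eqP: Ed; rewrite (dst_eq0 connected) => /eqP <-.
  have [u Gu Eu] := dst_pred connected Ed.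
  right; exists u, (dst_ord s u); split; rewrite /= ?Eu //.
  apply: IH => //; last exact: ltnW.
  (* From [u] to [v] the distance to [s] grows by exactly one and that to any other source by at
     most one, so the sources ahead of [s] at [u] stay ahead at [v]. *)
  have : rank b s u <= rank b s v; last by move: E; rewrite Ed Eu; lia.
  apply: subset_leq_card; apply/subsetP => x; rewrite !inE => /andP[-> /=].
  by have := dst_edge connected x Gu; rewrite /dst_key Ed Eu; nia.
rewrite told_runS in_setU.
case Hold: (_ \in told _ _) => //=; rewrite inE /announce run_clock.
rewrite (late_before B smp Gsym connected root0 _ _ (R1_ge B)) leqNgt Ht /=.
have Helig : eligible v (smp v) (run t v) b (dst_ord s v, s).
  rewrite /eligible [knows _ _ _ _ _]Hknow /=; apply/existsP => -[d /= /andP[Hd]].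
  move=> Hin; have [_ Hd'] := told_dst Hin.
  have Ed : d = dst_ord s v by apply: val_inj => /=; lia.
  by rewrite -Ed Hin in Hold.
have Hmin q : eligible v (smp v) (run t v) b q -> dst_key s v <= entry_key q.
  case: q => d' s' /andP[/= /knows_dst[Hs' Hd'] /existsPn H].
  rewrite leqNgt; apply/negP => Hlt.
  have Hk : dst_key s' v < dst_key s v.
    by apply: leq_ltn_trans Hlt; rewrite /dst_key /entry_key /= leq_add2r leq_mul2r Hd' orbT.
  have Hdd : dst s' v <= dst s v.
    by move: Hk; rewrite /dst_key; have := ltn_ord s; nia.
  have Hr2 := rank_lt _ _ Hk Hs'.
  have Hin : (dst_ord s' v, s') \in told (run t v) b.
    by apply: IH => //; [lia | exact: ltnW].
  by have := H (dst_ord s' v); rewrite /= Hd' Hin.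
case: pickP => [p /andP[Hp /forallP Hall]|/(_ (dst_ord s v, s))]; last first.
  rewrite Helig /= => /forallP H; case: H => q; apply/implyP => /Hmin; exact.
apply/eqP; congr Some; apply: entry_key_inj; apply/eqP; rewrite eqn_leq.
by rewrite (implyP (Hall _)) // Hmin.
Qed.

End Detection.

(** * Election and extraction of a cycle *)

Lemma minimizerP (T : finType) (key : T -> nat) z0 (P : pred T) :
  let z := minimizer key z0 P in
  (z = z0 \/ P z) /\ key z <= key z0 /\ forall z', P z' -> key z <= key z'.
Proof.
rewrite /minimizer /=; case: arg_minnP => [|z Hz Hmin]; first by rewrite eqxx.
split; first by case/orP: Hz => [/eqP|]; auto.
by split=> [|z' Pz']; apply: Hmin; rewrite ?eqxx ?Pz' ?orbT.
Qed.

(** * Flooding the minimum of a key *)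

Section Flood.
Variables (n : nat) (G : rel 'I_n) (T : finType) (key : T -> nat).
Hypothesis key_inj : injective key.
Hypothesis connected : forall u v, within G n.-1 u v.
Variables (val : nat -> 'I_n -> T) (diam : nat) (root : 'I_n).
Hypothesis dst_diam : forall u v, dst G u v <= diam.
Variable offered : nat -> 'I_n -> pred T.
Hypothesis valS : forall k v, val k.+1 v = minimizer key (val k v) (offered k v).
Hypothesis offeredE : forall k v z,
  offered k v z = [exists u, G u v && (val k u == z)].

Lemma flood_key_le k u v : dst G u v <= k -> key (val k v) <= key (val 0 u).
Proof.
elim: k v => [|k IH] v; first by rewrite leqn0 (dst_eq0 connected) => /eqP ->.
rewrite valS; have [_ [Hle Hn]] := minimizerP key (val k v) (offered k v).
rewrite leq_eqVlt => /orP[/eqP E|/IH H]; last exact: leq_trans H.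
have [w Gwv Ew] := dst_pred connected E.
apply: (@leq_trans (key (val k w))); last by apply: IH; rewrite Ew.
by apply: Hn; rewrite offeredE; apply/existsP; exists w; rewrite Gwv eqxx.
Qed.

Lemma flood_origin k v : exists u, val k v = val 0 u.
Proof.
elim: k v => [|k IH] v; first by exists v.
have := minimizerP key (val k v) (offered k v).
rewrite /= -valS offeredE => -[[E|/existsP[u /andP[_ /eqP E]]] _].
  by have [w Ew] := IH v; exists w; rewrite E.
by have [w Ew] := IH u; exists w; rewrite -E.
Qed.

(** After [diam] rounds each value is an initial one with key at most every initial key; injectivity
    of [key] then makes all values equal. *)
Lemma flood : exists2 z, (exists u, val 0 u = z) /\ (forall u, key z <= key (val 0 u)) &
  forall k v, diam <= k -> val k v = z.
Proof.
have Hmin k v u : diam <= k -> key (val k v) <= key (val 0 u).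
  by move=> Hk; apply: flood_key_le; apply: leq_trans Hk.
have [u0 Eu0] := flood_origin diam root; exists (val 0 u0).
  by split=> [|u]; [exists u0 | rewrite -Eu0; apply: Hmin].
move=> k v Hk; apply: key_inj; apply/eqP; rewrite eqn_leq Hmin //=.
by have [u ->] := flood_origin k v; rewrite -Eu0 Hmin.
Qed.

End Flood.

(** * The simple cycle closed by a non-tree edge *)

Section CloseCycle.
Variables (n : nat) (G : rel 'I_n) (f : 'I_n -> 'I_n) (x y : 'I_n) (a b : nat).
Hypothesis Gsym : forall u v, G u v = G v u.
Hypothesis f_edge : forall u, f u = u \/ G u (f u).
Hypotheses (Gyx : G y x) (neq_xy : x != y) (fx : f x != y) (fy : f y != x).
Hypothesis meet : iter a f x = iter b f y.
Hypothesis meet_min : forall i j, iter i f x = iter j f y -> a + b <= i + j.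

Lemma path_traject u m : (forall i, i < m -> iter i.+1 f u <> iter i f u) ->
  path G u (traject f (f u) m).
Proof.
elim: m u => [|m IH] u H //=; apply/andP; split.
  by case: (f_edge u) => // E; case: (H 0 isT E).
apply: IH => i Hi; rewrite -!iterSr; exact: H.
Qed.

Lemma iter_fix i m u : iter i.+1 f u = iter i f u -> i <= m -> iter m f u = iter i f u.
Proof. by move=> E /subnK <-; elim: (m - i) => // k IH; rewrite addSn /= IH. Qed.

(** Follow [f] from [x] to the meeting point and return along the climb from [y]. Minimality of
    [a + b] excludes a repetition within one climb, a vertex common to both before the meeting, and
    a fixed point of [f] on the way. *)
Lemma close_cycle : has_cycle_of_length G (a + b).+1.
Proof.
have Ua i : i < a -> iter i f x <> iter a f x.
  by move=> Hi E; have := @meet_min i b; rewrite E => /(_ meet); lia.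
have Ub j : j < b -> iter j f y <> iter b f y.
  by move=> Hj E; have := @meet_min a j; rewrite E => /(_ meet); lia.
pose s := traject f x a.+1 ++ rev (traject f y b).
have Ss : size s == (a + b).+1 by rewrite size_cat size_rev !size_traject addSn.
apply/andP; split.
  (* Length at least 3 means [a + b >= 2]; the three smaller cases contradict [neq_xy], [fx] and
     [fy]. *)
  have H1 : (a, b) <> (0, 0) by case=> Ea Eb; move: meet neq_xy; rewrite Ea Eb /= => ->; rewrite eqxx.
  have H2 : (a, b) <> (1, 0) by case=> Ea Eb; move: meet fx; rewrite Ea Eb /= => ->; rewrite eqxx.
  have H3 : (a, b) <> (0, 1) by case=> Ea Eb; move: meet fy; rewrite Ea Eb /= => <-; rewrite eqxx.
  by move: (a) (b) H1 H2 H3 => [|[|a']] [|[|b']].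
apply/existsP; exists (Tuple Ss); apply/andP; split; rewrite [tval _](erefl s) /s.
  rewrite cat_uniq rev_uniq looping_uniq; apply/and3P; split.
  - by apply/trajectP => -[i /Ua H E]; case: H.
  - apply/hasPn => z; rewrite mem_rev => /trajectP[j Hj ->]; apply/negP.
    by move=> /trajectP[i Hi] /esym/meet_min; lia.
  - have : uniq (traject f y b.+1); last by rewrite trajectSr rcons_uniq => /andP[].
    by rewrite looping_uniq; apply/trajectP => -[i /Ub H E]; case: H.
rewrite /= rcons_cat cat_path path_traject /=; last first.
  by move=> i Hi E; apply: (Ua i Hi); rewrite (iter_fix E) // ltnW.
have -> : last x (traject f (f x) a) = last x (traject f y b.+1).
  by rewrite last_traject meet -last_traject.
have -> : rcons (rev (traject f y b)) x = rev (belast x (traject f y b.+1)).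
  by rewrite trajectSr belast_rcons rev_cons.
rewrite rev_path /= Gyx /=.
rewrite (@eq_path _ _ G) => [|u v]; last exact: Gsym.
by apply: path_traject => i Hi E; apply: (Ub i Hi); rewrite (iter_fix E) // ltnW.
Qed.

End CloseCycle.

Lemma witness_key_inj n : injective (@witness_key n).
Proof.
have lt (w : 'I_(2 * n).+1) (l : bool * 'I_n * 'I_n * 'I_n) :
    witness_key (Some (w, l)) < (2 * n).+1 * #|{: bool * 'I_n * 'I_n * 'I_n}|.
  rewrite /witness_key; have := ltn_ord w; have := ltn_ord (enum_rank l).
  set c := #|_|; set r := enum_rank l; nia.
move=> [[w l]|] [[w' l']|] //= E.
- have Ew : w = w'.
    apply: val_inj; have := congr1 (divn^~ #|{: bool * 'I_n * 'I_n * 'I_n}|) E.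
    have c0 : 0 < #|{: bool * 'I_n * 'I_n * 'I_n}| by apply/card_gt0P; exists l.
    by rewrite /= !divnMDl // !divn_small // !addn0.
  by move: E; rewrite Ew => /addnI/val_inj/enum_rank_inj ->.
- by have := lt w l; rewrite /= E ltnn.
- by have := lt w' l'; rewrite /= -E ltnn.
Qed.

Lemma witness_key_le n (w w' : 'I_(2 * n).+1) l l' :
  witness_key (Some (w, l)) <= witness_key (Some (w', l')) -> w <= w'.
Proof.
rewrite /=; have := ltn_ord (enum_rank l'); set c := #|_|.
set r := enum_rank l'; set r0 := enum_rank l; nia.
Qed.

Lemma witness_key_lt_None n w l : @witness_key n (Some (w, l)) < @witness_key n None.
Proof.
rewrite /witness_key; have := ltn_ord w; have := ltn_ord (enum_rank l).
set c := #|_|; set r := enum_rank l; nia.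
Qed.

(** * The phases after source detection *)

Section Phases.
Variables (n B : nat) (G : rel 'I_n) (smp : 'I_n -> bool).
Hypothesis Gsym : forall u v, G u v = G v u.
Hypothesis Girr : forall v, ~~ G v v.
Hypothesis connected : forall u v, within G n.-1 u v.
Variable root : 'I_n.
Hypothesis root0 : root = 0 :> nat.

Notation dst := (dst G).
Notation run := (run B G smp).
Notation last_late := (last_late G root).
Notation T1 := (R1 B last_late).
Notation T2 := (R2 B last_late).
Notation T3 := (R3 B last_late).
Notation T4 := (R4 B last_late).

Lemma told_frozen t v b : T1 <= t -> told (run t v) b = told (run T1 v) b.
Proof.
move=> /subnKC <-; elim: (t - T1) => [|k IH]; first by rewrite addn0.
rewrite addnS told_runS IH; apply/setP => p; rewrite in_setU inE /announce run_clock.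
by rewrite (late_before B smp Gsym connected root0 _ _ (R1_ge B)) leq_addr orbF.
Qed.

Lemma heard_frozen t v b : T1 <= t -> heard (run t v) b = heard (run T1 v) b.
Proof. by move=> H; rewrite !run_heard; apply/setP => q; rewrite !inE told_frozen. Qed.

Definition fest b s v := est v (b || smp v) (heard (run T1 v) b) s.
Definition fpar b s v := par v (b || smp v) (heard (run T1 v) b) s.
Definition up b s v := odflt v (fpar b s v).

(** The parent announced one less than the estimate of [v], and its own final estimate is at most
    what it announced. Estimates need not be true distances, yet this strict decrease makes every
    climb end at the source. *)
Lemma fpar_Some b s v u : fpar b s v = Some u -> G u v /\ fest b s u < fest b s v.
Proof.
rewrite /fpar /par; case: pickP => // u1 /existsP[[u' [d s']]] H [Eu].
move: H; rewrite Eu => /and4P[Hq /eqP /= Eq /eqP /= Es /eqP /= E].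
move: Hq; rewrite run_heard inE /= Eq Es => /andP[Gu Hd].
split=> //; rewrite /fest -E ltnS; apply: run_est; first exact: ltnW.
exact: told_knows Hd.
Qed.

Lemma fpar_None b s v : fest b s v <= n -> fpar b s v = None -> v = s.
Proof.
move=> /knows_est/run_knowsP[[_ [_ ->]] //|[u [d [Gu Hd E]]]].
rewrite /fpar /par; case: pickP => // /(_ u)/existsP[].
by exists (u, (d, s)); rewrite /= !eqxx E eqxx !andbT run_heard inE /= Gu.
Qed.

Lemma reach_source b s v : fest b s v <= n ->
  exists2 k, k <= fest b s v & iter k (up b s) v = s.
Proof.
move: {2}(fest b s v) (leqnn (fest b s v)) => m; elim: m v => [|m IH] v Hm Hn;
  case E: (fpar b s v) => [u|]; try by exists 0; rewrite // (fpar_None Hn E).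
  by have [_] := fpar_Some E; lia.
have [_ Hu] := fpar_Some E; have [||k Hk Ek] := IH u; [lia | lia |].
by exists k.+1; [lia | rewrite iterSr /up E].
Qed.

Notation atE := (fun Hf t v => late_at B smp Gsym connected root0 t v Hf).

Definition inbox t v :=
  [ffun u => if G u v then Some (speak B u (smp u) (run t u)) else None].

Lemma best_runS t v : best (run t.+1 v) =
  if t == T1 then minimizer (@witness_key n) None (is_candidate v (smp v) (run T1 v))
  else minimizer (@witness_key n) (best (run t v))
         (fun z => hears (inbox t v) (fun _ m => m_best m == z)).
Proof. by rewrite [LHS]/= run_clock (atE (R1_ge B)); case: eqP => // ->. Qed.

Lemma mark_runS t v sd : mark (run t.+1 v) sd =
  if t == T2 then
    if best (run t v) is Some (_, (_, _, y0, y1)) then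
      if v == (if sd then y1 else y0) then Some ord0 else None
    else None
  else if mark (run t v) sd is Some c then Some c
  else [pick c : 'I_(2 * n).+1 | hears (inbox t v) (fun _ m =>
          (m_par m == Some v) &&
          (if m_mark m sd is Some c0 then c0.+1 == c else false))].
Proof. by rewrite [LHS]/= run_clock (atE (R2_ge B)). Qed.

Lemma res_runS t v : res (run t.+1 v) =
  if t == T3 then
    if (mark (run t v) false, mark (run t v) true) is (Some c0, Some c1)
    then inord (c0 + c1).+1 else ord_max
  else minimizer (@nat_of_ord _) (res (run t v))
         (fun z => hears (inbox t v) (fun _ m => m_res m == z)).
Proof. by rewrite [LHS]/= run_clock (atE (R3_ge B)). Qed.

Lemma best_flood : exists2 z,
  (z = None \/ exists v, is_candidate v (smp v) (run T1 v) z) /\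
  (forall v z', is_candidate v (smp v) (run T1 v) z' -> witness_key z <= witness_key z') &
  forall t v, T2 <= t -> best (run t v) = z.
Proof.
have [||z [[u Hz] Hmin] Hk] := @flood n G _ _ (@witness_key_inj n) connected
  (fun k v => best (run (T1.+1 + k) v)) _ root (dst_last_late Gsym connected root0)
  (fun k v z => hears (inbox (T1.+1 + k) v) (fun _ m => m_best m == z)).
- by move=> k v; rewrite addnS best_runS gtn_eqF // addSn ltnS leq_addr.
- by move=> k v z; rewrite hearsE.
have bestT1 v : best (run (T1.+1 + 0) v) =
    minimizer (@witness_key n) None (is_candidate v (smp v) (run T1 v)).
  by rewrite addn0 best_runS eqxx.
exists z; last first.
  move=> t v Ht; have := Hk (t - T1.+1) v; rewrite subnKC; last by rewrite /R2 in Ht *; lia.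
  by apply; rewrite /R2 in Ht *; lia.
split.
  have := minimizerP (@witness_key n) None (is_candidate u (smp u) (run T1 u)).
  by rewrite /= -bestT1 Hz => -[[->|H] _]; [left | right; exists u].
move=> v z' Hz'; apply: leq_trans (Hmin v) _; rewrite bestT1.
by have [_ [_ H]] := minimizerP (@witness_key n) None (is_candidate v (smp v) (run T1 v)); apply: H.
Qed.

(** * The two tokens climbing from the elected edge *)

Section Trace.
Variables (w : 'I_(2 * n).+1) (b : bool) (s x y : 'I_n).
Hypothesis bestE : forall t v, T2 <= t -> best (run t v) = Some (w, (b, s, x, y)).
Let src (sd : bool) := if sd then y else x.

Lemma trace0 v sd : mark (run T2.+1 v) sd = if v == src sd then Some ord0 else None.
Proof. by rewrite mark_runS eqxx bestE. Qed.

Lemma traceS k v sd : mark (run (T2.+1 + k).+1 v) sd =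
  if mark (run (T2.+1 + k) v) sd is Some c then Some c
  else [pick c : 'I_(2 * n).+1 | [exists u, [&& G u v, fpar b s u == Some v &
          if mark (run (T2.+1 + k) u) sd is Some c0 then c0.+1 == c else false]]].
Proof.
move: (T2.+1 + k) (leq_addr k T2.+1) => t Ht.
rewrite mark_runS gtn_eqF //; case: (mark _ _) => //.
apply: eq_pick => c; rewrite /= hearsE; apply: eq_existsb => u.
rewrite /m_par /m_mark /= ffunE /best_par bestE; last by rewrite ltnW.
by rewrite heard_frozen //; apply: leq_trans (ltnW Ht); exact: leq_addr.
Qed.

Lemma trace_keep k k' v sd c : mark (run (T2.+1 + k) v) sd = Some c -> k <= k' ->
  mark (run (T2.+1 + k') v) sd = Some c.
Proof.
move=> H /subnKC <-; elim: (k' - k) => [|j IH]; first by rewrite addn0.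
by rewrite !addnS traceS IH.
Qed.

(** Hop counts are numbers of parent steps, so a node carrying both marks witnesses a meeting of the
    two climbs. *)
Lemma trace_sound k v sd c : mark (run (T2.+1 + k) v) sd = Some c ->
  c <= k /\ iter c (up b s) (src sd) = v.
Proof.
elim: k v c => [|k IH] v c.
  by rewrite addn0 trace0; case: eqP => // -> [<-].
rewrite addnS traceS; case E: (mark _ _) => [c0|].
  by move=> [<-]; have [H1 H2] := IH _ _ E; split=> //; apply: leqW.
case: pickP => // c1 /existsP[u /and3P[_ /eqP Hu]].
case Eu: (mark _ _) => [c0|//] /eqP Ec [Ec1]; rewrite -Ec1 -Ec.
by have [H1 H2] := IH _ _ Eu; split=> //; rewrite iterS H2 /up Hu.
Qed.

Lemma trace_complete c sd : c <= 2 * n ->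
  (forall i, i < c -> fpar b s (iter i (up b s) (src sd)) <> None) ->
  exists2 c' : 'I_(2 * n).+1, c' <= c &
    forall k, c <= k -> mark (run (T2.+1 + k) (iter c (up b s) (src sd))) sd = Some c'.
Proof.
elim: c => [|c IH] Hc Hpar.
  by exists ord0 => // k; apply: trace_keep; rewrite addn0 trace0 eqxx.
have [||c0 Hc0 /(_ c (leqnn c)) H0] := IH; [exact: ltnW | by move=> i /leqW; apply: Hpar |].
set v := iter c.+1 _ _.
suff [c' Hm] : exists c', mark (run (T2.+1 + c.+1) v) sd = Some c'.
  have [H1 _] := trace_sound Hm; exists c' => // k; exact: trace_keep.
rewrite addnS traceS; case: (mark (run _ v) sd) => [c'|]; first by exists c'.
case: pickP => [c' _|]; first by exists c'.
have Hlt : c0.+1 < (2 * n).+1 by lia.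
move=> /(_ (Ordinal Hlt))/existsPn/(_ (iter c (up b s) (src sd))).
rewrite H0 /= eqxx andbT /v iterS /up.
case E: (fpar _ _ _) => [u|]; last by case: (Hpar c (ltnSn c)).
by have [Gu _] := fpar_Some E; rewrite Gsym Gu /= eqxx.
Qed.

(** The result is one plus the least total number of steps at which the climbs meet. They meet at
    [s] at the latest, which gives [L <= w]; the bound on [w] leaves the tokens enough rounds
    between [T2] and [T3]. *)
Lemma res_final : is_candidate x (smp x) (run T1 x) (Some (w, (b, s, x, y))) ->
  w <= 4 * last_late + 5 ->
  exists L, [/\ forall t v, T4 <= t -> res (run t v) = L :> nat,
    has_cycle_of_length G L & L <= w].
Proof.
move=> /and3P[_ /eqP Hxy /existsP[d /and3P[Hq Hdx /eqP Ew]]] HwD.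
rewrite -/(fest b s x) in Hdx Ew.
move: Hq; rewrite run_heard inE /= => /andP[Gyx Hd].
have {}Hxy : fpar b s x <> Some y by [].
have Hy : fest b s y <= d by apply: run_est (told_knows Hd); apply: ltnW.
have Hx : fest b s x <= n.
  apply: (@leq_trans d.+1); last exact: ltn_ord.
  by apply: run_est (ltn_ord d) _; apply/run_knowsP; right; exists y, d.
have neq_xy : x != y by apply: contraTneq Gyx => ->; apply: Girr.
have f_edge u : up b s u = u \/ G u (up b s u).
  by rewrite /up; case E: (fpar b s u) => [u'|]; [right; rewrite Gsym; case: (fpar_Some E) | left].
have fx : up b s x != y.
  rewrite /up; case: (fpar b s x) Hxy => [u'|] //= H.
  by apply/eqP => Eu; apply: H; rewrite Eu.
have fy : up b s y != x.
  rewrite /up; case E: (fpar b s y) => [u'|] /=; last by rewrite eq_sym.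
  by apply/eqP => Eu; have [_] := fpar_Some E; rewrite Eu; lia.
have [kx Hkx Ekx] := reach_source Hx.
have [ky Hky Eky] : exists2 k, k <= fest b s y & iter k (up b s) y = s.
  by apply: reach_source; have := ltn_ord d; lia.
(* The climbs meet after [m] steps in total; the least such [m] is taken. *)
pose P m := [exists i : 'I_m.+1, iter i (up b s) x == iter (m - i) (up b s) y].
have HP i j : iter i (up b s) x = iter j (up b s) y -> P (i + j).
  move=> E; apply/existsP; have Hi : i < (i + j).+1 by rewrite ltnS leq_addr.
  by exists (Ordinal Hi); rewrite /= E addKn.
have exP : exists m, P m by exists (kx + ky); apply: HP; rewrite Ekx.
case: (ex_minnP exP) => m /existsP[i /eqP meet] Hmin.
have Hm : i + (m - i) = m by rewrite subnKC // -ltnS.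
move: (nat_of_ord i) (m - i) meet Hm => a c meet Hm.
have meet_min i' j' : iter i' (up b s) x = iter j' (up b s) y -> a + c <= i' + j'.
  by rewrite Hm => /HP/Hmin.
have Hw : (a + c).+1 <= w by rewrite Ew; have := meet_min _ _ (etrans Ekx (esym Eky)); lia.
exists (a + c).+1; split=> //; last exact: (close_cycle Gsym f_edge Gyx neq_xy fx fy meet meet_min).
have Hwn := ltn_ord w.
have Hmarks t v c0 c1 : T2.+1 <= t ->
    mark (run t v) false = Some c0 -> mark (run t v) true = Some c1 -> a + c <= c0 + c1.
  move=> /subnKC <- /trace_sound[_ E0] /trace_sound[_ E1].
  by apply: meet_min; rewrite E0 E1.
(* No proposal is too small: two marks witness a meeting, and the default [ord_max] exceeds [w]. *)
have resT3 v : (a + c).+1 <= res (run T3.+1 v).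
  rewrite res_runS eqxx; have Hge : T2.+1 <= T3 by rewrite /R3; lia.
  case E0: (mark _ false) => [c0|]; last by rewrite /=; lia.
  case E1: (mark _ true) => [c1|]; last by rewrite /=; lia.
  rewrite inordK ?ltnS; first exact: Hmarks E0 E1.
  by have := ltn_ord c0; have := ltn_ord c1; lia.
have [ca Hca Eca] : exists2 ca : 'I_(2 * n).+1, ca <= a &
    mark (run T3 (iter a (up b s) x)) false = Some ca.
  have [||ca Hca H] := @trace_complete a false; first by lia.
    (* A missing parent before step [a] would stop the climb there, and the meeting would have
       happened earlier. *)
    move=> i' Hi' E; have Efix : iter i'.+1 (up b s) x = iter i' (up b s) x.
      by rewrite iterS /up E.
    have := @meet_min i' c; rewrite -(iter_fix Efix (ltnW Hi')) => /(_ meet); lia.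
  exists ca => //; have := H (T3 - T2.+1); rewrite subnKC /R3; last by lia.
  by apply; lia.
have [cc Hcc Ecc] : exists2 cc : 'I_(2 * n).+1, cc <= c &
    mark (run T3 (iter a (up b s) x)) true = Some cc.
  rewrite meet; have [||cc Hcc H] := @trace_complete c true; first by lia.
    move=> i' Hi' E; have Efix : iter i'.+1 (up b s) y = iter i' (up b s) y.
      by rewrite iterS /up E.
    have := @meet_min a i'; rewrite -(iter_fix Efix (ltnW Hi')) => /(_ meet); lia.
  exists cc => //; have := H (T3 - T2.+1); rewrite subnKC /R3; last by lia.
  by apply; lia.
have resT3' : res (run T3.+1 (iter a (up b s) x)) <= (a + c).+1.
  by rewrite res_runS eqxx Eca Ecc inordK; lia.
have [||z [[u Hz] Hzmin] Hk] := @flood n G _ _ (@ord_inj (4 * n).+3) connected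
  (fun k v => res (run (T3.+1 + k) v)) _ root (dst_last_late Gsym connected root0)
  (fun k v z => hears (inbox (T3.+1 + k) v) (fun _ m => m_res m == z)).
- by move=> k v; rewrite addnS res_runS gtn_eqF // addSn ltnS leq_addr.
- by move=> k v z; rewrite hearsE.
move=> t v Ht; have Ht' : T3.+1 + (2 * last_late + 2) <= t by rewrite /R4 in Ht; lia.
have := Hk (t - T3.+1) v; rewrite subnKC => [->|]; [|lia|lia].
have := Hzmin (iter a (up b s) x); rewrite -Hz !addn0 => H.
by apply/eqP; rewrite eqn_leq resT3 andbT; apply: leq_trans H resT3'.
Qed.

End Trace.

End Phases.

(** * Existence of a short candidate *)

Lemma cycle_from n (G : rel 'I_n) (q : seq 'I_n) c : cycle G q -> uniq q -> c \in q ->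
  exists f : nat -> 'I_n,
  [/\ f 0 = c /\ f (size q) = c, forall i, i < size q -> G (f i) (f i.+1),
      forall i j, i < size q -> j < size q -> f i = f j -> i = j &
      forall i, i < size q -> f i \in q].
Proof.
move=> Gq Uq /rot_to[k p E]; have Sq : size q = (size p).+1 by rewrite -(size_rot k) E.
exists (nth c (rcons (c :: p) c)); rewrite Sq.
have nthE i : i < (size p).+1 -> nth c (rcons (c :: p) c) i = nth c (c :: p) i.
  by move=> Hi; rewrite nth_rcons Hi.
split.
- by split=> //; rewrite nth_rcons ltnn eqxx.
- move=> i Hi; have : cycle G (c :: p) by rewrite -E rot_cycle.
  by move=> /(pathP c)/(_ i); rewrite size_rcons; apply.
- move=> i j Hi Hj; rewrite !nthE // => /eqP.
  by rewrite nth_uniq ?(rot_uniq k) -?E ?rot_uniq //= => [/eqP||]; rewrite ?E.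
- by move=> i Hi; rewrite nthE // -(mem_rot k) E mem_nth.
Qed.

(** * Distances along a closed walk, in both directions *)

Section CycleDistance.
Variables (n : nat) (G : rel 'I_n) (s : 'I_n) (f : nat -> 'I_n) (g : nat).
Hypothesis connected : forall u v, within G n.-1 u v.
Hypothesis f_edge : forall i, i < g -> G (f i) (f i.+1).

Lemma dst_cycle_l i : i <= g -> dst G s (f i) <= dst G s (f 0) + i.
Proof.
elim: i => [|i IH] Hi; first by rewrite addn0.
by have := dst_edge connected s (f_edge Hi); have := IH (ltnW Hi); lia.
Qed.

Hypothesis Gsym : forall u v, G u v = G v u.
Hypothesis f_closed : f g = f 0.

Lemma dst_cycle_r i : i <= g -> dst G s (f i) <= dst G s (f 0) + (g - i).
Proof.
move=> Hi; rewrite -{1}(subKn Hi); move: (leq_subr i g); elim: (g - i) => [|j IH] Hj.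
  by rewrite subn0 f_closed addn0.
have Hlt : g - j.+1 < g by lia.
have := f_edge Hlt; rewrite Gsym => /(dst_edge connected s).
by have := IH (ltnW Hj); rewrite (_ : (g - j.+1).+1 = g - j); lia.
Qed.

End CycleDistance.

(** * Candidates from samples near the cycle or from small balls *)

Section Completeness.
Variables (n B : nat) (G : rel 'I_n) (smp : 'I_n -> bool).
Hypothesis Gsym : forall u v, G u v = G v u.
Hypothesis Girr : forall v, ~~ G v v.
Hypothesis connected : forall u v, within G n.-1 u v.
Variable root : 'I_n.
Hypothesis root0 : root = 0 :> nat.

Notation dst := (dst G).
Notation run := (run B G smp).
Notation last_late := (last_late G root).
Notation T1 := (R1 B last_late).

Section Candidate.
Variables (b : bool) (s : 'I_n) (f : nat -> 'I_n) (g : nat).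
Hypothesis f_closed : f g = f 0.
Hypothesis f_edge : forall i, i < g -> G (f i) (f i.+1).

Hypothesis f_inj : forall i j, i < g -> j < g -> f i = f j -> i = j.
Hypothesis g3 : 3 <= g.
Hypothesis f0_min : forall i, i <= g -> dst s (f 0) <= dst s (f i).

Let farthest i := [/\ 0 < i, i < g & forall j, j <= g -> dst s (f j) <= dst s (f i)].

(** The ends [f 0] and [f g] are the same nearest vertex, so a maximum over the inner indices is a
    maximum over all. *)
Lemma farthest_exists : exists i, farthest i.
Proof.
have Hg : 1 < g by lia.
pose P (i : 'I_g) := 0 < i.
have [i Hi Hmax] := @arg_maxnP _ (Ordinal Hg) P (fun i => dst s (f i)) isT.
exists i; split=> // j; rewrite leq_eqVlt => /orP[/eqP->|Hj].
  by rewrite f_closed; apply: f0_min; apply: ltnW.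
case: j Hj => [_|j Hj]; first by apply: f0_min; apply: ltnW.
exact: (Hmax (Ordinal Hj)).
Qed.

Hypothesis exact_at : forall i, farthest i ->
  [/\ run_knows B G smp T1 b (f i) (dst s (f i)) s,
      (dst_ord connected s (f i.-1), s) \in told (run T1 (f i.-1)) b &
      (dst_ord connected s (f i.+1), s) \in told (run T1 (f i.+1)) b].

(** The two cycle neighbours of a farthest vertex [x] differ because [g >= 3], so one of them is not
    its parent; it is no farther than [x]. Bounding the two distances along opposite arcs of the
    cycle gives the estimate on [w]. *)
Lemma candidate_exists : exists v w l,
  [/\ is_candidate v (smp v) (run T1 v) (Some (w, l)),
      w <= 2 * dst s (f 0) + g & w <= 4 * last_late + 5].
Proof.
have [i Hi] := farthest_exists; have [Hk H1 H2] := exact_at Hi.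
case: Hi => i0 ig Hmax; set x := f i in Hk Hmax.
have Eest : est x (b || smp x) (heard (run T1 x) b) s = dst s x.
  have H : est x (b || smp x) (heard (run T1 x) b) s <= dst s x.
    by apply: run_est Hk; rewrite ltnW // ltn_dst.
  apply/eqP; rewrite eqn_leq H; apply: (proj2 (knows_dst connected _)).
  by apply: knows_est; apply: leq_trans H _; rewrite ltnW // ltn_dst.
have cand y : G y x -> dst s y <= dst s x ->
    (dst_ord connected s y, s) \in told (run T1 y) b ->
    par x (b || smp x) (heard (run T1 x) b) s <> Some y ->
    exists w l, is_candidate x (smp x) (run T1 x) (Some (w, l)) /\
                w = (dst s x + dst s y).+1 :> nat.
  move=> Gyx Hyx Hin Hpar.
  have Hw : (dst s x + dst s y).+1 < (2 * n).+1.
    by have := ltn_dst connected s x; have := ltn_dst connected s y; lia.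
  exists (Ordinal Hw), (b, s, x, y); split=> //; rewrite /is_candidate eqxx /= Eest.
  apply/andP; split; first exact/eqP.
  apply/existsP; exists (dst_ord connected s y); rewrite Hyx eqxx !andbT.
  by rewrite run_heard inE /= Gyx.
have Hd u v : dst u v <= 2 * last_late + 2 by apply: dst_last_late.
have Eprev : i.-1.+1 = i by rewrite prednK.
have Gp : G (f i.-1) x by have := @f_edge i.-1; rewrite Eprev; apply; apply: ltnW.
have Gn : G (f i.+1) x by rewrite Gsym; apply: f_edge.
have neq : f i.-1 <> f i.+1.
  case: (ltngtP i.+1 g) ig => [ig _|//|ig _]; first by move/f_inj; lia.
  by rewrite ig f_closed => /f_inj; lia.
have [E|Hpar] := eqVneq (par x (b || smp x) (heard (run T1 x) b) s) (Some (f i.-1)).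
  have [||||w [l [Hc Hw]]] := cand (f i.+1) => //.
  - exact: Hmax.
  - by rewrite E => -[].
  exists x, w, l; split=> //; rewrite Hw; last by have := Hd s x; have := Hd s (f i.+1); lia.
  have := dst_cycle_l s connected f_edge (ltnW ig).
  have := dst_cycle_r s connected f_edge Gsym f_closed ig; rewrite -/x; lia.
have [||||w [l [Hc Hw]]] := cand (f i.-1) => //.
- by apply: Hmax; lia.
- exact/eqP.
exists x, w, l; split=> //; rewrite Hw; last by have := Hd s x; have := Hd s (f i.-1); lia.
have Hi1 : i.-1 <= g by lia.
have := dst_cycle_l s connected f_edge Hi1.
have := dst_cycle_r s connected f_edge Gsym f_closed (ltnW ig); rewrite -/x; lia.
Qed.

End Candidate.

Lemma told_exact b s v : b || smp s -> rank G smp b s v <= B ->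
  (dst_ord connected s v, s) \in told (run T1 v) b.
Proof.
move=> Hs Hr; apply: (detection Gsym connected root0 Hs _ (leqnn _)).
have := dst_last_late Gsym connected root0 s v; rewrite /R1; lia.
Qed.

Variable g : nat.
Hypothesis cycle_g : has_cycle_of_length G g.
Hypothesis few_samples : #|[set u | smp u]| <= B.
Hypothesis big_balls_hit : forall v, B <= #|[set u | within G (g.-1)./2 v u]| ->
  exists2 s, smp s & within G (g.-1)./2 v s.

Lemma good_candidate : exists v w l,
  [/\ is_candidate v (smp v) (run T1 v) (Some (w, l)),
      w <= (2 * g).-1 & w <= 4 * last_late + 5].
Proof.
case/andP: cycle_g => g3 /existsP[q /andP[Uq Gq]].
have hit := big_balls_hit; set r := (g.-1)./2 in hit.
have Hr : 2 * r <= g.-1 by rewrite /r; lia.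
have Sq : size q = g by rewrite size_tuple.
(* With a sampled [s] within [r] of the cycle, at most [B] samples compete, so all distances from
   [s] are exact, and [2 * r + g <= 2 * g - 1]. *)
have [/hasP[c cq /existsP[s /andP[Hs Hcs]]]|Hno] :=
    boolP (has (fun c => [exists s, smp s && within G r c s]) q).
  have [c0 c0q Hmin] : exists2 c0, c0 \in q & forall x, x \in q -> dst s c0 <= dst s x.
    have [c0 c0q Hmin] := @arg_minnP _ c (mem q) (dst s) cq.
    by exists c0.
  have [f [[f0 fg] fE fI fq]] := cycle_from Gq Uq c0q.
  rewrite Sq in fg fE fI fq.
  have f0_min i : i <= g -> dst s (f 0) <= dst s (f i).
    rewrite leq_eqVlt f0 => /orP[/eqP->|/fq]; first by rewrite fg.
    exact: Hmin.
  have told_all v : (dst_ord connected s v, s) \in told (run T1 v) false.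
    by apply: told_exact => //; apply: leq_trans few_samples; apply: rank_sample.
  have [||v [w [l [Hc Hw1 Hw2]]]] := @candidate_exists false s f g _ fE fI g3 f0_min.
  - by rewrite fg.
  - by move=> i _; split=> //; apply: (told_knows (told_all (f i))).
  exists v, w, l; split=> //; apply: leq_trans Hw1 _; rewrite f0.
  have := Hmin _ cq; rewrite (withinE connected) (dst_sym Gsym connected) in Hcs; lia.
(* Without a sample near the cycle, balls around it are small, and so are the ranks of sources
   within distance [r]. *)
have small v : v \in q -> #|[set u | within G r v u]| <= B.
  move=> vq; rewrite leqNgt; apply/negP => /ltnW/hit[s Hs Hw].
  by move/hasPn/(_ v vq)/existsPn/(_ s): Hno; rewrite Hs Hw.
have [s sq] : exists s, s \in q.
  have g0 : 0 < g by lia.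
  by exists (tnth q (Ordinal g0)); apply: mem_tnth.
have [f [[f0 fg] fE fI fq]] := cycle_from Gq Uq sq; rewrite Sq in fg fE fI fq.
have f_closed : f g = f 0 by rewrite fg.
have fqg i : i <= g -> f i \in q.
  by rewrite leq_eqVlt => /orP[/eqP->|/fq //]; rewrite fg.
have d0 : dst s (f 0) = 0 by rewrite f0 (dst_refl connected).
have told_near i : i <= g -> dst s (f i) <= r ->
    (dst_ord connected s (f i), s) \in told (run T1 (f i)) true.
  move=> Hi Hd; apply: told_exact => //; apply: leq_trans (small _ (fqg _ Hi)).
  by apply: ltnW; apply: rank_all.
have [||v [w [l [Hc Hw1 Hw2]]]] := @candidate_exists true s f g f_closed fE fI g3.
- by move=> i _; rewrite d0.
- move=> i [i0 ig Hmax].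
  have Hl j := @dst_cycle_l n G s f g connected fE j.
  have Hrr j := @dst_cycle_r n G s f g connected fE Gsym f_closed j.
  rewrite d0 in Hl Hrr.
  have [Hi|Hi] := leqP (dst s (f i)) r.
    split; first by apply: (told_knows (told_near _ (ltnW ig) Hi)).
      by apply: told_near; [lia | apply: leq_trans (Hmax _ _) Hi; lia].
    by apply: told_near; [lia | apply: leq_trans (Hmax _ _) Hi; lia].
  (* [g = 2r + 2] and [f i] is the antipode of [s], outside the balls of radius [r]
     but adjacent to two vertices inside. *)
  have := Hl i (ltnW ig); have := Hrr i (ltnW ig) => Hri Hli.
  have Hp : (dst_ord connected s (f i.-1), s) \in told (run T1 (f i.-1)) true.
    by apply: told_near; [lia | apply: leq_trans (Hl _ _) _; rewrite /r in Hi *; lia].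
  have Hn : (dst_ord connected s (f i.+1), s) \in told (run T1 (f i.+1)) true.
    by apply: told_near; [lia | apply: leq_trans (Hrr _ _) _; rewrite /r in Hi *; lia].
  split=> //; have Hprev : dst s (f i) = (dst s (f i.-1)).+1.
    have Hi1 : i.-1 < g by lia.
    have := dst_edge connected s (fE _ Hi1); rewrite prednK //.
    have := Hl i.-1 (ltnW Hi1); rewrite /r in Hi *; lia.
  apply/run_knowsP; right; exists (f i.-1), (dst_ord connected s (f i.-1)).
  split=> //; have := fE i.-1; rewrite prednK //; apply; exact: ltnW.
by exists v, w, l; split=> //; apply: leq_trans Hw1 _; rewrite d0; lia.
Qed.

Lemma girth_alg_correct : exists L,
  [/\ forall t v, R4 B last_late <= t -> res (run t v) = L :> nat,
      has_cycle_of_length G L & L <= (2 * g).-1].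
Proof.
have [z [Hz Hmin] Hbest] := best_flood B smp Gsym connected root0.
have [v [w [l [Hc Hw1 Hw2]]]] := good_candidate.
have := Hmin _ _ Hc.
case: z Hz Hmin Hbest => [[w' [[[b s] x] y]]|] Hz _ Hbest Hle; last first.
  by have := @witness_key_lt_None n w l; rewrite ltnNge Hle.
have Hww := witness_key_le Hle.
case: Hz => [//|[u Hu]]; have Eu : x = u by case/and3P: Hu => /eqP.
rewrite -Eu in Hu.
have [|L [H1 H2 H3]] := res_final Gsym Girr connected root0 Hbest Hu.
  exact: leq_trans Hw2.
by exists L; split=> //; apply: leq_trans H3 _; apply: leq_trans Hw1.
Qed.

End Completeness.

(** * Sampling *)

Lemma leq_exp2rW a b k : a <= b -> a ^ k <= b ^ k.
Proof. by case: k => // k; rewrite leq_exp2r. Qed.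

(** These are the first two terms of the binomial expansion. *)
Lemma expn_succ_ge a k : a ^ k.+1 + k.+1 * a ^ k <= a.+1 ^ k.+1.
Proof.
elim: k => [|k IH]; first by rewrite !expn1 expn0 muln1 addn1.
rewrite (expnS a.+1); apply: leq_trans (leq_mul (leqnn a.+1) IH).
rewrite (expnS a k.+1) (expnS a k); move: (a ^ k) => c; nia.
Qed.

Lemma double_expn_pred q : 0 < q -> 2 * q.-1 ^ q <= q ^ q.
Proof.
case: q => // a _; rewrite /=; apply: leq_trans (expn_succ_ge a a).
by rewrite [a.+1 * _]mulSn -expnS mul2n -addnn leq_add2l leq_addl.
Qed.

Lemma expn_succ_le q k : k <= q -> q.+1 ^ k <= k.+1 * q ^ k.
Proof.
elim: k => [|k IH] Hk //; rewrite !expnS.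
apply: leq_trans (leq_mul (leqnn q.+1) (IH (ltnW Hk))) _.
by move: (q ^ k) => c; nia.
Qed.

(** Cut the exponent [m] into blocks of length [q] and a remainder: each multiplies the ratio of the
    powers by at most [q.+1]. A constant per block would be true, but this loses only a logarithm in
    the budget. *)
Lemma expn_succ_le_div q m : 0 < q -> q.+1 ^ m <= q.+1 ^ (m %/ q).+1 * q ^ m.
Proof.
move=> q0; rewrite {1 3}(divn_eq m q) !expnD [m %/ q * q]mulnC !expnM expnS.
have Hr : q.+1 ^ (m %% q) <= q.+1 * q ^ (m %% q).
  apply: leq_trans (expn_succ_le (ltnW (ltn_pmod m q0))) _.
  by rewrite leq_mul2r ltnW ?orbT // ltnS ltn_pmod.
have Hq : (q.+1 ^ q) ^ (m %/ q) <= q.+1 ^ (m %/ q) * (q ^ q) ^ (m %/ q).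
  by rewrite -expnMn; apply: leq_exp2rW; apply: expn_succ_le.
by apply: leq_trans (leq_mul Hq Hr) _; rewrite mulnACA [X in X * _]mulnC.
Qed.

Section Sampling.
Variables (I X : finType) (P : pred X).
Hypothesis P1 : #|P| = 1.
Notation q := #|X|.

Lemma card_X_gt0 : 0 < q.
Proof. by rewrite -P1 max_card. Qed.

Lemma card_miss (A : {set I}) :
  #|[set f : {ffun I -> X} | [forall v in A, ~~ P (f v)]]| = q.-1 ^ #|A| * q ^ #|~: A|.
Proof.
have HC : #|[pred t | ~~ P t]| = q.-1 by have := cardC P; rewrite P1 => <-.
(* The indicator of missing [A] is a product over the vertices, so its sum over all functions
   factorises: the samples are independent. *)
transitivity (\sum_(f : {ffun I -> X}) \prod_v ((v \in A) ==> ~~ P (f v) : nat)).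
  rewrite -sum1_card big_mkcond; apply: eq_bigr => f _; rewrite inE.
  case: ifPn => [/forallP H|/forallPn[v Hv]]; first by rewrite big1 // => v _; rewrite H.
  by rewrite (bigD1 v) //= (negbTE Hv).
rewrite -(bigA_distr_bigA (fun v t => ((v \in A) ==> ~~ P t : nat))) /=.
rewrite (bigID (mem A)) /=; congr (_ * _).
  rewrite (eq_bigr (fun=> q.-1)) ?prod_nat_const // => v ->.
  by rewrite -HC -sum1_card [RHS]big_mkcond; apply: eq_bigr => t _; rewrite inE; case: (P t).
rewrite (eq_bigr (fun=> q)) => [|v /negbTE ->]; last by rewrite sum1_card.
by rewrite prod_nat_const; congr (_ ^ _); apply: eq_card => v; rewrite !inE.
Qed.

(** Each group of [q] vertices contains no sample with probability [(1 - 1/q)^q <= 1/2]. *)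
Lemma card_miss_le (A : {set I}) m : q * m <= #|A| ->
  2 ^ m * #|[set f : {ffun I -> X} | [forall v in A, ~~ P (f v)]]| <= q ^ #|I|.
Proof.
move=> HA; rewrite card_miss -(cardsC A) expnD mulnA leq_mul2r; apply/orP; right.
rewrite -(subnKC HA) !expnD mulnA; apply: leq_mul; last exact/leq_exp2rW/leq_pred.
by rewrite !expnM -expnMn; apply/leq_exp2rW/double_expn_pred/card_X_gt0.
Qed.

(* Markov's inequality for [2 ^ #|samples|], whose total is [(q + 1) ^ #|I|]. *)
Lemma card_many_le K :
  2 ^ K * #|[set f : {ffun I -> X} | K <= #|[set v | P (f v)]|]| <= q.+1 ^ #|I|.
Proof.
have -> : q.+1 ^ #|I| = \sum_(f : {ffun I -> X}) 2 ^ #|[set v | P (f v)]|.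
  transitivity (\sum_(f : {ffun I -> X}) \prod_v (P (f v)).+1); last first.
    apply: eq_bigr => f _; rewrite -prod_nat_const [RHS]big_mkcond.
    by apply: eq_bigr => v _; rewrite inE; case: (P _).
  rewrite -(bigA_distr_bigA (fun _ t => (P t).+1)) prod_nat_const; congr (_ ^ _).
  rewrite [RHS](eq_bigr (fun t => 1 + P t)) // big_split /= sum1_card.
  have -> : \sum_t (P t : nat) = 1; last by rewrite addn1.
  by rewrite -P1 -sum1_card [RHS]big_mkcond.
rewrite mulnC -sum_nat_const.
rewrite [leqRHS](bigID (fun f : {ffun I -> X} => K <= #|[set v | P (f v)]|)) /=.
apply: leq_trans (leq_addr _ _).
rewrite (eq_bigl (fun f : {ffun I -> X} => K <= #|[set v | P (f v)]|)).
  by apply: leq_sum => f Hf; rewrite leq_exp2l.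
by move=> f; rewrite inE.
Qed.

End Sampling.

(** * The theorem *)

Definition log_size n := (trunc_log 2 n).+1.
Definition sqrt_size n := (Nat.sqrt n).+1.
(* A node is sampled when its tape, of this length, is constantly true. *)
Definition sample_bits n := trunc_log 2 (sqrt_size n).
(** It serves as ball size threshold, bound on the number of samples, and allowance for pipelining.
    The first summand makes large balls hit, the second bounds the samples, each up to a small
    failure probability. *)
Definition budget n :=
  sqrt_size n * (2 * log_size n).+1 + (log_size n).+1 * (2 * sqrt_size n + 2).

(** The total is [13 * a + 26] plus the budget, and the budget is at most 11 times
    [sqrt_size n * log_size n]; hence 37. *)
Lemma R4_budget n a D : a <= D -> R4 (budget n) a <= round_bound 37 1 n D.
Proof.
rewrite /R4 /R3 /R2 /R1 /round_bound /budget /sqrt_size -/(log_size n) expn1.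
have : 0 < log_size n by [].
move: (log_size n) (Nat.sqrt n) => l r; nia.
Qed.

Lemma first_outputE (A : congest_alg) n (G : rel 'I_n)
    (tapes : {ffun 'I_n -> (rbits A n).-tuple bool}) T v t0 k :
  (forall t, out_at A G tapes t v = if t == t0 then Some k else None) -> t0 <= T ->
  first_output A G tapes T v = Some k.
Proof.
move=> H Ht; rewrite /first_output -(subnKC (leqW Ht : t0 <= T.+1)) iotaD foldr_cat.
rewrite subSn //= add0n H eqxx.
have : all (fun t => t < t0) (iota 0 t0) by apply/allP => t; rewrite mem_iota.
elim: (iota 0 t0) => //= t r IH /andP[Ht0 /IH ->]; by rewrite H ltn_eqF.
Qed.

Lemma has_cycle_le n (G : rel 'I_n) L : has_cycle_of_length G L -> L <= n.
Proof.
move=> /andP[_ /existsP[q /andP[Uq _]]]; rewrite -{1}(size_tuple q).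
by rewrite -(card_uniqP Uq) -[leqRHS]card_ord max_card.
Qed.

Lemma girth_alg_outputs n (G : rel 'I_n) D g :
  let A := girth_alg sample_bits budget in
  simple_graph G -> is_diameter G D -> is_girth G g ->
  forall tapes : {ffun 'I_n -> (rbits A n).-tuple bool},
  #|[set v | all id (tapes v)]| <= budget n ->
  (forall v, budget n <= #|[set u | within G (g.-1)./2 v u]| ->
     exists2 s, all id (tapes s) & within G (g.-1)./2 v s) ->
  exists L, [/\ forall v, first_output A G tapes (round_bound 37 1 n D) v = Some L,
    has_cycle_of_length G L & g <= L <= (2 * g).-1].
Proof.
move=> A [Gsym Girr] [HD _] [cycle_g min_g] tapes few hit.
have connected u v : within G n.-1 u v by apply: within_pred_card (HD u v).
have n0 : 0 < n.
  by have := has_cycle_le cycle_g; case/andP: cycle_g; lia.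
pose root := Ordinal n0; have root0 : root = 0 :> nat by [].
have [L [Hres Lcycle HL]] := girth_alg_correct Gsym Girr connected root0 cycle_g few hit.
exists L; split=> //; last by rewrite min_g.
move=> v; apply: (@first_outputE A _ _ _ _ _ (R4 (budget n) (last_late G root))).
  move=> t; rewrite /out_at /= hist_run run_clock.
  rewrite (late_at (budget n) _ Gsym connected root0 _ _ (R4_ge _)).
  by case: eqP => // ->; rewrite Hres.
exact/R4_budget/(last_late_le connected).
Qed.

Lemma trunc_log_double m : 0 < m -> 2 ^ trunc_log 2 m <= m < 2 * 2 ^ trunc_log 2 m.
Proof. by move=> m0; rewrite -expnS trunc_logP // trunc_log_ltn. Qed.

Lemma few_bad_tapes n (ball : 'I_n -> {set 'I_n}) :
  n * #|[set tapes : {ffun 'I_n -> (sample_bits n).-tuple bool} |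
      (budget n < #|[set v | all id (tapes v)]|) ||
      [exists v, (budget n <= #|ball v|) && [forall u in ball v, ~~ all id (tapes u)]]]|
  <= #|{ffun 'I_n -> (sample_bits n).-tuple bool}|.
Proof.
set X : finType := (sample_bits n).-tuple bool; pose P : pred X := fun t => all id t.
have P1 : #|P| = 1.
  rewrite -(card1 [tuple of nseq (sample_bits n) true]); apply: eq_card => t.
  rewrite !unfold_in /P /= -val_eqE /=; apply/idP/eqP => [H|->].
    have /all_pred1P -> : all (pred1 true) t by apply: sub_all H; case.
    by rewrite size_tuple.
  by rewrite all_nseq orbT.
pose q := #|X|; have Eq : q = 2 ^ sample_bits n by rewrite /q card_tuple card_bool.
have /andP[qS Sq] : q <= sqrt_size n < 2 * q by rewrite Eq trunc_log_double.
have q0 : 0 < q by rewrite Eq expn_gt0.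
have nSS : n < sqrt_size n * sqrt_size n.
  by have [_] := PeanoNat.Nat.sqrt_spec n (PeanoNat.Nat.le_0_l n); rewrite /sqrt_size; lia.
have Sn : sqrt_size n <= n.+1.
  by have [+ _] := PeanoNat.Nat.sqrt_spec n (PeanoNat.Nat.le_0_l n); rewrite /sqrt_size; nia.
have nq : n %/ q < 2 * sqrt_size n by rewrite ltn_divLR //; nia.
pose p := 2 ^ log_size n; have np : n < p by apply: trunc_log_ltn.
pose l := log_size n.
pose many := [set f : {ffun 'I_n -> X} | budget n <= #|[set v | P (f v)]|].
pose miss v := if budget n <= #|ball v|
  then [set f : {ffun 'I_n -> X} | [forall u in ball v, ~~ P (f u)]] else set0.
(* Too many samples: probability at most [1 / (2 * p)], where [n < p]. *)
have Hmany : 2 * p * #|many| <= q ^ n.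
  have H := @card_many_le 'I_n _ _ P1 (budget n); rewrite card_ord -/q -/many in H.
  have Hq : q.+1 ^ (n %/ q).+1 <= 2 ^ (l.+1 * (n %/ q).+1).
    by rewrite expnM leq_exp2r // (leq_ltn_trans qS) // (leq_ltn_trans Sn) // /l expnS -/p; lia.
  have Hb : l.+1 * (n %/ q).+1 + l.+1 <= budget n by rewrite /budget -/l; nia.
  have H1 := leq_trans H (leq_trans (expn_succ_le_div n q0) (leq_mul Hq (leqnn _))).
  rewrite -(leq_pmul2l (m := 2 ^ (l.+1 * (n %/ q).+1))) ?expn_gt0 //.
  apply: leq_trans H1; rewrite mulnA leq_mul2r -expnS -expnD leq_exp2l //.
  by rewrite Hb orbT.
(* Missing one large ball has probability at most [1 / (2 * p * p)], leaving room for a union bound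
   over the [n] centres. *)
have Hmiss v : 2 * p * p * #|miss v| <= q ^ n.
  rewrite /miss; case: ifP => [Hb|_]; last by rewrite cards0 muln0.
  have Hball : q * (l + l).+1 <= #|ball v|.
    by apply: leq_trans Hb; rewrite /budget -/l addnn -mul2n; nia.
  by have := card_miss_le P1 Hball; rewrite card_ord expnS expnD mulnA.
set bad := [set tapes | _].
have Hbad : #|bad| <= #|many| + \sum_v #|miss v|.
  have /subset_leq_card/leq_trans-> // : bad \subset many :|: \bigcup_v miss v.
    apply/subsetP => f; rewrite in_setU !inE => /orP[/ltnW -> //|/existsP[v /andP[Hb Hf]]].
    by apply/orP; right; apply/bigcupP; exists v => //; rewrite /miss Hb inE.
  apply: leq_trans (leq_card_setU _ _) _; rewrite leq_add2l.
  elim/big_ind2: _ => [|k A m C H1 H2|//]; first by rewrite cards0.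
  by apply: leq_trans (leq_card_setU _ _) (leq_add H1 H2).
have Hsum : 2 * p * (\sum_v #|miss v|) <= q ^ n.
  have p0 : 0 < p by rewrite expn_gt0.
  rewrite -(leq_pmul2l p0) mulnA [p * (2 * p)]mulnC big_distrr /=.
  apply: (@leq_trans (\sum_(v < n) q ^ n)); first by apply: leq_sum => v _.
  by rewrite sum_nat_const card_ord leq_mul2r (ltnW np) orbT.
rewrite card_ffun card_ord -/q.
have arith (N m M t p' : nat) :
    2 * p' * m <= t -> 2 * p' * M <= t -> N <= m + M -> n < p' -> n * N <= t by nia.
exact: arith Hmany Hsum Hbad np.
Qed.

Theorem theorem6 :
  exists (A : congest_alg) (cB cw c k : nat),
    msg_bounded A cB /\ 1 <= cw /\
    forall (n : nat) (G : rel 'I_n) (D g : nat),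
      simple_graph G -> is_diameter G D -> is_girth G g ->
      let T := round_bound c k n D in
      let good (tapes : {ffun 'I_n -> (rbits A n).-tuple bool}) : bool :=
        [exists gt : 'I_n.+1,
           [forall v, first_output A G tapes T v == Some (nat_of_ord gt)] &&
           has_cycle_of_length G gt &&
           ((g <= gt)%N &&
            ((gt%:R : rat) <= (2 - 1 / (g%:R : rat)) * (g%:R : rat))%R)] in
      (n ^ cw * #|[set tapes | ~~ good tapes]| <=
         #|{ffun 'I_n -> (rbits A n).-tuple bool}|)%N.
Proof.
exists (girth_alg sample_bits budget), 24, 1, 37, 1.
split; first exact: girth_alg_msg_bounded.
split; first by [].
move=> n G D g simpleG diamG girthG; cbv zeta; set T := round_bound _ _ _ _.
apply: leq_trans (few_bad_tapes (fun v => [set u | within G (g.-1)./2 v u])).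
rewrite expn1 leq_mul2l; apply/orP; right; apply/subset_leq_card/subsetP => tapes.
rewrite !inE; apply: contraNT; rewrite negb_or -leqNgt => /andP[few /existsPn hit].
have hit' v : budget n <= #|[set u | within G (g.-1)./2 v u]| ->
    exists2 s, all id (tapes s) & within G (g.-1)./2 v s.
  move=> Hv; move: (hit v); rewrite Hv /= => /forall_inPn[s]; rewrite inE negbK.
  by move=> H1 H2; exists s.
have [L [HL Lcycle /andP[gL LH]]] := girth_alg_outputs simpleG diamG girthG few hit'.
have Ln : L < n.+1 by rewrite ltnS (has_cycle_le Lcycle).
apply/existsP; exists (Ordinal Ln); rewrite Lcycle gL /= andbT; apply/andP; split.
  by apply/forallP => v; apply/eqP/HL.
have g0 : 0 < g by case: girthG => /andP[H _] _; apply: leq_trans H.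
have gU : (g%:R : rat) != 0%R by rewrite pnatr_eq0 -lt0n.
(* The rational bound [(2 - 1/g) * g] is the integer [2 * g - 1]. *)
rewrite mulrBl div1r mulVf // -natrM -(natrB _ (n := 1)) ?ler_nat ?subn1 //.
by rewrite muln_gt0.
Qed.
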